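(* Let $\mathcal{H}$ be a separable infinite-dimensional complex Hilbert space. Let $A\in\mathcal{B}(\mathcal{H})$ be singular with closed range, let $b\in\mathcal{H}$, and suppose the set $S=\{x\in\mathcal{H}: Ax=b\}$ is not empty. Let $T\in\mathcal{B}(\mathcal{H})$ be an invertible positive diagonalizable operator (with closed range), $T=U^*T_kU$ with $U$ unitary and $T_k$ diagonal, and let $X$ be the unique positive solution of the equation $X^2=T_k$. Then the problem of minimizing $\langle x,Tx\rangle$ over $x\in S$ has the unique solution $$\hat{x}=U^*X^{-1}(AU^*X^{-1})^\dagger b.$$
   Context: $\mathcal{B}(\mathcal{H})$ denotes the bounded linear operators on $\mathcal{H}$. A self-adjoint operator $T\in\mathcal{B}(\mathcal{H})$ is positive if $\langle Tx,x\rangle\ge 0$ for all $x\in\mathcal{H}$. Invertible means having a bounded inverse; singular means not invertible. An invertible positive operator $T$ is diagonalizable if $T=U^*T_kU$, where $U$ is unitary (from $\mathcal{H}$ onto $\ell^2$, i.e. coordinates in an orthonormal basis are used) and $T_k$ is a diagonal operator $T_k(x_1,x_2,\ldots)=(k_1x_1,k_2x_2,\ldots)$ with $(k_n)_n$ a bounded sequence of positive real numbers. The operator $X$ is the diagonal operator with diagonal entries $\sqrt{k_n}$. For a bounded operator $B$ with closed range between Hilbert spaces, $B^\dagger$ denotes its generalized (Moore-Penrose) inverse, the unique bounded operator satisfying $BB^\dagger=(BB^\dagger)^*$, $B^\dagger B=(B^\dagger B)^*$, $BB^\dagger B=B$, $B^\dagger BB^\dagger=B^\dagger$. (Under the hypotheses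 the operator $AU^*X^{-1}$ has closed range, so its Moore-Penrose inverse exists as a bounded operator.) *)

(* Defs.v *)
From HB Require Import structures.
From mathcomp Require Import all_boot all_order all_algebra.
From mathcomp Require Import sesquilinear complex.
From mathcomp Require Import ring lra.
From mathcomp Require Import all_classical all_reals all_analysis.

Set Implicit Arguments.
Unset Strict Implicit.
Unset Printing Implicit Defensive.

Import Order.TTheory GRing.Theory Num.Theory.
Import numFieldNormedType.Exports.
Local Open Scope classical_set_scope.
Local Open Scope ring_scope.

Section dot_norm.
Variables (C : numClosedFieldType) (U : lmodType C) (f : {dot U for Num.conj}).

Lemma dot_CauchySchwarz (u v : U) : `|f u v| ^+ 2 <= f u u * f v v.
Proof.
have [->|v0] := eqVneq v 0; first by rewrite !linear0r normr0 expr0n.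
have fv : 0 < f v v by rewrite dnorm_gt0.
have fvc : (f v v)^* = f v v by rewrite geC0_conj// ltW.
have := dnorm_ge0 f (f v v *: u - f u v *: v).
have E : f (f v v *: u) (f u v *: v) = f v v * ((f u v)^* * f u v).
  by rewrite linearZl_LR; congr (_ * _); rewrite linearZr_LR.
rewrite dnormB !dnormZ E [`|f v v|]ger0_norm ?(ltW fv)//.
rewrite !rmorphM/= conjCK fvc.
have -> : f v v * ((f u v)^* * f u v) = f v v * `|f u v| ^+ 2.
  by rewrite normCK [_^* * _]mulrC.
have -> : f v v * (f u v * (f u v)^*) = f v v * `|f u v| ^+ 2.
  by rewrite normCK.
rewrite (_ : _ + _ - _ = f v v * (f u u * f v v - `|f u v| ^+ 2)); last by ring.
by rewrite pmulr_rge0// subr_ge0.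
Qed.

Lemma dot_triangle (u v : U) :
  sqrtC (f (u + v) (u + v)) <= sqrtC (f u u) + sqrtC (f v v).
Proof.
rewrite -ler_sqr ?nnegrE ?addr_ge0 ?sqrtC_ge0//.
rewrite sqrrD !sqrtCK dnormD addrAC lerD2r lerD2l.
have -> : f u v + (f u v)^* = 'Re (f u v) *+ 2.
  by rewrite ReE -mulr_natr divfK// pnatr_eq0.
rewrite lerMn2r/=; apply: le_trans (leif_Re_Creal _) _.
rewrite -sqrtCM ?nnegrE// -[leLHS](sqrCK (normr_ge0 _)) ler_sqrtC ?nnegrE//.
- exact: dot_CauchySchwarz.
- by rewrite mulr_ge0.
Qed.

End dot_norm.

(* Norms take their values in the scalar field R[i], following normedModType;
   the inner product is linear in its first argument and conjugate-linear in
   the second one. *)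
HB.mixin Record CompleteNormedModule_isHilbert (R : realType) H
    & CompleteNormedModule R[i] H := {
  inner : {dot H for Num.conj};
  inner_norm : forall x : H, inner x x = `|x| ^+ 2
}.

#[short(type="hilbertType")]
HB.structure Definition Hilbert (R : realType) :=
  {H of CompleteNormedModule R[i] H & CompleteNormedModule_isHilbert R H}.

Section complex_limits.
Variable R : realType.
Implicit Types (z w : R[i]) (u v : R[i]^nat).

Lemma conj_complexE (a b : R) : ((a +i* b)%C : R[i])^* = (a -i* b)%C.
Proof. by []. Qed.

Lemma Re_mul z w : complex.Re (z * w) =
  complex.Re z * complex.Re w - complex.Im z * complex.Im w.
Proof. by case: z w => [a b] [c d]. Qed.

Lemma Im_mul z w : complex.Im (z * w) =
  complex.Re z * complex.Im w + complex.Im z * complex.Re w.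
Proof. by case: z w => [a b] [c d]. Qed.

Lemma Re_conj z : complex.Re z^* = complex.Re z.
Proof. by case: z. Qed.

Lemma Im_conj z : complex.Im z^* = - complex.Im z.
Proof. by case: z. Qed.

(* |z|^2 as an element of R *)
Definition sqrnc z : R := complex.Re (`|z| ^+ 2).

Lemma sqrncE z : sqrnc z = complex.Re z ^+ 2 + complex.Im z ^+ 2.
Proof.
by rewrite /sqrnc normCK Re_mul Re_conj Im_conj mulrN opprK !expr2.
Qed.

Lemma sqrncC z : (sqrnc z)%:C%C = `|z| ^+ 2.
Proof.
have := exprn_ge0 2 (normr_ge0 z); rewrite lecE => /andP[/eqP h _].
by apply/eqP; rewrite eq_complex h; apply/andP; split.
Qed.

Lemma sqrnc_ge0 z : 0 <= sqrnc z.
Proof. by rewrite sqrncE addr_ge0// sqr_ge0. Qed.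

Lemma sqrnc_eq0 z : (sqrnc z == 0) = (z == 0).
Proof.
case: z => a b; rewrite sqrncE paddr_eq0 ?sqr_ge0//= !sqrf_eq0.
by rewrite eq_complex.
Qed.

Lemma sqrncD z w : sqrnc (z + w) <= 2 * sqrnc z + 2 * sqrnc w.
Proof.
case: z w => [a b] [c d]; rewrite !sqrncE/= -subr_ge0.
rewrite (_ : _ - _ = (a - c) ^+ 2 + (b - d) ^+ 2); last by ring.
by rewrite addr_ge0// sqr_ge0.
Qed.

Lemma sqrncM z w : sqrnc (z * w) = sqrnc z * sqrnc w.
Proof. by rewrite !sqrncE Re_mul Im_mul; ring. Qed.

Lemma Re_mul_conj_le z w : `|complex.Re (z * w^*)| <= sqrnc z + sqrnc w.
Proof.
rewrite !sqrncE Re_mul Re_conj Im_conj.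
move: (complex.Re z) (complex.Im z) (complex.Re w) (complex.Im w) => a b c d.
have := (sqr_ge0 (a + c), sqr_ge0 (b + d), sqr_ge0 (a - c), sqr_ge0 (b - d)).
have := (sqr_ge0 a, sqr_ge0 b, sqr_ge0 c, sqr_ge0 d).
move=> [[[? ?] ?] ?] [[[? ?] ?] ?].
by rewrite ler_norml; apply/andP; split; nra.
Qed.

Lemma Im_mul_conj_le z w : `|complex.Im (z * w^*)| <= sqrnc z + sqrnc w.
Proof.
rewrite !sqrncE Im_mul Re_conj Im_conj.
move: (complex.Re z) (complex.Im z) (complex.Re w) (complex.Im w) => a b c d.
have := (sqr_ge0 (a + d), sqr_ge0 (b + c), sqr_ge0 (a - d), sqr_ge0 (b - c)).
have := (sqr_ge0 a, sqr_ge0 b, sqr_ge0 c, sqr_ge0 d).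
move=> [[[? ?] ?] ?] [[[? ?] ?] ?].
by rewrite ler_norml; apply/andP; split; nra.
Qed.

Definition ccvg u (l : R[i]) :=
  complex.Re (u n) @[n --> \oo] --> complex.Re l /\
  complex.Im (u n) @[n --> \oo] --> complex.Im l.

(* R[i] carries no topology in the library: limits of complex sequences are
   taken on real and imaginary parts. *)
Definition clim u : R[i] :=
  (limn (fun n => complex.Re (u n)) +i* limn (fun n => complex.Im (u n)))%C.

Lemma ccvg_lim u l : ccvg u l -> clim u = l.
Proof.
by case: l => a b [/= ua ub]; rewrite /clim; congr (_ +i* _)%C; exact/cvg_lim.
Qed.

Lemma ccvgB u v l m : ccvg u l -> ccvg v m -> ccvg (fun n => u n - v n) (l - m).
Proof.
move=> [ul1 ul2] [vm1 vm2]; split.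
- under eq_fun do rewrite raddfB/=.
  by rewrite raddfB; exact: cvgB.
- under eq_fun do rewrite raddfB/=.
  by rewrite raddfB; exact: cvgB.
Qed.

Lemma ccvgZ z u l : ccvg u l -> ccvg (fun n => z * u n) (z * l).
Proof.
move=> [ul1 ul2]; split.
- under eq_fun do rewrite Re_mul.
  by rewrite Re_mul; apply: cvgB; apply: cvgMr.
- under eq_fun do rewrite Im_mul.
  by rewrite Im_mul; apply: cvgD; apply: cvgMr.
Qed.

Lemma ccvg_conj u l : ccvg u l -> ccvg (fun n => (u n)^*) l^*.
Proof.
move=> [ul1 ul2]; split.
- by under eq_fun do rewrite Re_conj; rewrite Re_conj.
- by under eq_fun do rewrite Im_conj; rewrite Im_conj; exact: cvgN.
Qed.

End complex_limits.

Section ell2_def.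
Variable R : realType.

Definition square_summable (x : R[i]^nat) : Prop :=
  cvgn (series (fun n => sqrnc (x n))).

Lemma square_summableP (x : R[i]^nat) M :
  (forall N, series (fun n => sqrnc (x n)) N <= M) ->
  square_summable x /\ limn (series (fun n => sqrnc (x n))) <= M.
Proof.
move=> xM; have cvx : square_summable x.
  apply: nondecreasing_is_cvgn.
    by apply: nondecreasing_series => n _ _; exact: sqrnc_ge0.
  by exists M => _ [N _ <-].
by split=> //; apply: limr_le => //; exact: nearW.
Qed.

Lemma square_summable_ge (x : R[i]^nat) N : square_summable x ->
  series (fun n => sqrnc (x n)) N <= limn (series (fun n => sqrnc (x n))).
Proof.
move=> cvx; apply: nondecreasing_cvgn_le => //.
by apply: nondecreasing_series => n _ _; exact: sqrnc_ge0.
Qed.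

Definition ell2_pred : {pred nat -> R[i]} := [pred x | `[< square_summable x >]].

Lemma ell2_submod_closed : submod_closed ell2_pred.
Proof.
split=> [|a x y /asboolP sx /asboolP sy]; apply/asboolP.
  have [] := @square_summableP (0 : nat -> R[i]) 0 => // N.
  by rewrite /series/= big1// => n _; apply/eqP; rewrite sqrnc_eq0.
have := is_cvg_seriesD (is_cvg_seriesZ (k := 2 * sqrnc a) sx) (is_cvg_seriesZ (k := 2) sy).
apply: series_le_cvg => n; first exact: sqrnc_ge0.
- by rewrite addr_ge0// mulr_ge0// ?mulr_ge0// sqrnc_ge0.
- by apply: le_trans (sqrncD _ _) _; rewrite sqrncM mulrA.
Qed.

HB.instance Definition _ :=
  GRing.isSubmodClosed.Build R[i] (nat -> R[i]) ell2_pred ell2_submod_closed.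

(* The Hilbert space l^2 of square-summable complex sequences; the instances
   below equip it with its inner product, norm and completeness. *)
Record ell2 := Ell2 { ell2_seq :> nat -> R[i]; _ : ell2_seq \in ell2_pred }.

HB.instance Definition _ := [isSub for ell2_seq].
HB.instance Definition _ := [Choice of ell2 by <:].
HB.instance Definition _ := [SubChoice_isSubLmodule of ell2 by <:].

End ell2_def.

Section ell2_inner.
Variable R : realType.
Implicit Types x y z : ell2 R.

Lemma ell2_square_summable x : square_summable x.
Proof. by have /asboolP := valP x. Qed.

Definition ell2_inner x y : R[i] :=
  clim (series (fun n => x n * (y n)^*)).

Lemma Re_series (u : R[i]^nat) :
  (fun n => complex.Re (series u n)) = series (fun k => complex.Re (u k)).
Proof. by apply/funext => n; rewrite /series/= raddf_sum. Qed.

Lemma Im_series (u : R[i]^nat) :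
  (fun n => complex.Im (series u n)) = series (fun k => complex.Im (u k)).
Proof. by apply/funext => n; rewrite /series/= raddf_sum. Qed.

Lemma ell2_innerP x y :
  ccvg (series (fun n => x n * (y n)^*)) (ell2_inner x y).
Proof.
have sxy := is_cvg_seriesD (@ell2_square_summable x) (@ell2_square_summable y).
split; rewrite /ell2_inner/clim/=.
- rewrite !Re_series.
  apply: normed_cvg; apply: series_le_cvg sxy => n.
  + exact: normr_ge0.
  + exact: addr_ge0 (sqrnc_ge0 _) (sqrnc_ge0 _).
  + exact: Re_mul_conj_le.
- rewrite !Im_series.
  apply: normed_cvg; apply: series_le_cvg sxy => n.
  + exact: normr_ge0.
  + exact: addr_ge0 (sqrnc_ge0 _) (sqrnc_ge0 _).
  + exact: Im_mul_conj_le.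
Qed.

Lemma ell2_innerC x y : ell2_inner x y = (ell2_inner y x)^*.
Proof.
apply: ccvg_lim; have := ccvg_conj (ell2_innerP y x).
congr ccvg; apply/funext => n; rewrite /series/= rmorph_sum.
by apply: eq_bigr => k _; rewrite rmorphM/= conjCK mulrC.
Qed.

Lemma ell2_inner_zmod y : zmod_morphism (ell2_inner ^~ y).
Proof.
move=> x z; apply: ccvg_lim.
have := ccvgB (ell2_innerP x y) (ell2_innerP z y).
congr ccvg; apply/funext => n; rewrite /series/= -sumrB.
by apply: eq_bigr => k _; rewrite -mulrBl.
Qed.

Lemma ell2_inner_scale y : scalable_for *%R (ell2_inner ^~ y).
Proof.
move=> a x; apply: ccvg_lim; have := ccvgZ a (ell2_innerP x y).
congr ccvg; apply/funext => n; rewrite /series/= mulr_sumr.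
by apply: eq_bigr => k _; rewrite mulrA.
Qed.

Lemma ell2_inner_zmodr x : zmod_morphism (ell2_inner x).
Proof.
by move=> y z; rewrite ell2_innerC ell2_inner_zmod rmorphB/= -!ell2_innerC.
Qed.

Lemma ell2_inner_scaler x : scalable_for (Num.conj \; *%R) (ell2_inner x).
Proof.
by move=> a y; rewrite ell2_innerC ell2_inner_scale rmorphM/= -ell2_innerC.
Qed.

HB.instance Definition _ := isBilinear.Build R[i] (ell2 R) (ell2 R) R[i]
  *%R (Num.conj \; *%R) ell2_inner
  ell2_inner_zmod ell2_inner_zmodr ell2_inner_scale ell2_inner_scaler.

Lemma ell2_inner_herm x y :
  ell2_inner x y = (-1) ^+ false * (ell2_inner y x)^*.
Proof. by rewrite expr0 mul1r; exact: ell2_innerC. Qed.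

HB.instance Definition _ := isHermitianSesquilinear.Build R[i] (ell2 R)
  false Num.conj ell2_inner ell2_inner_herm.

Lemma ell2_innerxx x :
  ell2_inner x x = (limn (series (fun n => sqrnc (x n))))%:C%C.
Proof.
apply: ccvg_lim; split.
- rewrite Re_series (_ : (fun k => _) = (fun n => sqrnc (x n))).
    exact: ell2_square_summable.
  by apply/funext => k; rewrite /sqrnc normCK.
- rewrite Im_series (_ : series _ = cst 0); first exact: cvg_cst.
  apply/funext => n; rewrite /series/= big1// => k _.
  by rewrite -normCK -sqrncC.
Qed.

Lemma ell2_inner_gt0 x : x != 0 -> 0 < ell2_inner x x.
Proof.
move=> x0; rewrite ell2_innerxx ltcR.
have [n xn0] : exists n, x n != 0.
  apply: contra_neqP x0 => /forallNP xn; apply/val_inj/funext => n/=.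
  by apply/eqP; move: (xn n) => /negP; rewrite negbK.
apply: lt_le_trans (square_summable_ge n.+1 (@ell2_square_summable x)).
rewrite /series/= big_nat_recr//= ltr_wpDl ?sumr_ge0// => [k _|].
  exact: sqrnc_ge0.
by rewrite lt_def sqrnc_eq0 xn0 sqrnc_ge0.
Qed.

HB.instance Definition _ :=
  isDotProduct.Build R[i] (ell2 R) ell2_inner ell2_inner_gt0.

Definition ell2_dot : {dot (ell2 R) for Num.conj} := ell2_inner.

Definition ell2_norm x : R[i] := sqrtC (ell2_inner x x).

Lemma ell2_normD x y : ell2_norm (x + y) <= ell2_norm x + ell2_norm y.
Proof. exact: (dot_triangle ell2_dot). Qed.

Lemma ell2_normZ (a : R[i]) x : ell2_norm (a *: x) = `|a| * ell2_norm x.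
Proof.
rewrite /ell2_norm -!/(ell2_dot _ _) dnormZ sqrtCM ?nnegrE ?exprn_ge0//.
by rewrite sqrCK.
Qed.

Lemma ell2_norm0_eq0 x : ell2_norm x = 0 -> x = 0.
Proof.
move=> /eqP; rewrite /ell2_norm -/(ell2_dot _ _) sqrt_dnorm_eq0.
exact: eqP.
Qed.

HB.instance Definition _ := Lmodule_isNormed.Build R[i] (ell2 R)
  ell2_normD ell2_normZ ell2_norm0_eq0.

Lemma ell2_inner_norm x : ell2_dot x x = `|x| ^+ 2.
Proof. by rewrite sqrtCK. Qed.

End ell2_inner.

Section ell2_complete.
Variable R : realType.
Implicit Types x y z : ell2 R.

Lemma ell2_sqr_norm x :
  `|x| ^+ 2 = (limn (series (fun n => sqrnc (x n))))%:C%C.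
Proof. by rewrite -ell2_inner_norm; exact: ell2_innerxx. Qed.

Lemma ell2_norm_geP x (e : R) : 0 <= e -> `|x| <= e%:C%C ->
  forall N, series (fun n => sqrnc (x n)) N <= e ^+ 2.
Proof.
move=> e0 xe N; apply: le_trans (square_summable_ge N (@ell2_square_summable _ x)) _.
by rewrite -lecR -ell2_sqr_norm rmorphXn/= ler_sqr ?nnegrE ?ler0c//.
Qed.

Lemma ell2_norm_leP x (e : R) : 0 <= e ->
  (forall N, series (fun n => sqrnc (x n)) N <= e ^+ 2) -> `|x| <= e%:C%C.
Proof.
move=> e0 /square_summableP[_ xe].
by rewrite -ler_sqr ?nnegrE ?ler0c// ell2_sqr_norm -rmorphXn lecR.
Qed.

Lemma ell2_coord_le x (e : R) n : 0 <= e -> `|x| <= e%:C%C ->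
  `|complex.Re (x n)| <= e /\ `|complex.Im (x n)| <= e.
Proof.
move=> e0 /ell2_norm_geP => /(_ e0 n.+1) xe.
have {}xe : sqrnc (x n) <= e ^+ 2.
  apply: le_trans xe; rewrite /series/= big_nat_recr//= ler_wpDl//.
  by apply: sumr_ge0 => k _; exact: sqrnc_ge0.
split; rewrite -ler_sqr ?nnegrE// real_normK ?num_real//.
  by apply: le_trans xe; rewrite sqrncE lerDl sqr_ge0.
by apply: le_trans xe; rewrite sqrncE lerDr sqr_ge0.
Qed.

Lemma complex_gt0 (e : R[i]) : 0 < e -> exists2 r : R, 0 < r & e = r%:C%C.
Proof.
case: e => a b; rewrite ltcE => /andP[/eqP/= -> a0]; by exists a.
Qed.

Lemma ell2_complete (F : set_system (ell2 R)) :
  ProperFilter F -> cauchy F -> cvg F.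
Proof.
move=> FF /cauchy_ballP cF.
have cauF (r : R) : 0 < r ->
    \forall x \near F & y \near F, `|x - y| <= r%:C%C.
  move=> r0; have re : 0 < (r%:C%C : R[i]) by rewrite ltcR.
  by move: (cF _ re); apply: filterS => -[x y]/=; rewrite -ball_normE/= => /ltW.
have cRe n : cvg ((fun x : ell2 R => complex.Re (x n)) @ F).
  apply: cauchy_cvg; apply/cauchy_ballP => e e0.
  rewrite near_simpl.
  have e20 : 0 < e / 2 by rewrite divr_gt0.
  move: (cauF _ e20); apply: filterS => -[x y] /= xy.
  rewrite -ball_normE/= -raddfB.
  have [+ _] := ell2_coord_le n (ltW e20) xy.
  by move/le_lt_trans; apply; rewrite ltr_pdivrMr// ltr_pMr// ltr1n.
have cIm n : cvg ((fun x : ell2 R => complex.Im (x n)) @ F).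
  apply: cauchy_cvg; apply/cauchy_ballP => e e0.
  rewrite near_simpl.
  have e20 : 0 < e / 2 by rewrite divr_gt0.
  move: (cauF _ e20); apply: filterS => -[x y] /= xy.
  rewrite -ball_normE/= -raddfB.
  have [_ +] := ell2_coord_le n (ltW e20) xy.
  by move/le_lt_trans; apply; rewrite ltr_pdivrMr// ltr_pMr// ltr1n.
pose l : nat -> R[i] := fun n => (lim ((fun x : ell2 R => complex.Re (x n)) @ F) +i*
  lim ((fun x : ell2 R => complex.Im (x n)) @ F))%C.
have key (r : R) : 0 < r -> \forall x \near F, forall N,
    series (fun n => sqrnc ((x : ell2 R) n - l n)) N <= r ^+ 2.
  move=> r0; near=> x; move=> N.
  have xF : \forall y \near F, `|x - y| <= r%:C%C.
    by near: x; apply: nearP_dep; exact: cauF.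
  have cv : (fun y : ell2 R => series (fun n => sqrnc (x n - y n)) N) @ F -->
            series (fun n => sqrnc (x n - l n)) N.
    rewrite /series/=; apply: cvg_big => [|k _]; first exact: add_continuous.
    under eq_fun do rewrite sqrncE !raddfB/=.
    rewrite sqrncE !raddfB/=; apply: cvgD.
      under eq_fun do rewrite expr2; rewrite expr2.
      by apply: cvgM; apply: cvgB (cRe k); exact: cvg_cst.
    under eq_fun do rewrite expr2; rewrite expr2.
    by apply: cvgM; apply: cvgB (cIm k); exact: cvg_cst.
  rewrite -(cvg_lim _ cv)//; apply: limr_le; first by apply/cvg_ex; eexists; exact: cv.
  by apply: filterS xF => y xy; exact: (ell2_norm_geP (ltW r0) xy N).
have lS : l \in @ell2_pred R.
  have [x /square_summableP[sxl _]] := filter_ex (key 1 ltr01).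
  rewrite (_ : l = (x : nat -> R[i]) - (fun n => x n - l n)).
    by apply: rpredB; [exact: valP|exact/asboolP].
  by apply/funext => n /=; rewrite -[RHS]/(x n - (x n - l n)) opprB addrC subrK.
apply/cvg_ex; exists (Ell2 lS); apply/cvgrPdist_le => _ /complex_gt0[r r0 ->].
apply: filterS (key r r0) => x xr; rewrite distrC.
apply: ell2_norm_leP (ltW r0) _ => N. exact: xr.
Unshelve. all: by end_near. Qed.

HB.instance Definition _ := Uniform_isComplete.Build (ell2 R) ell2_complete.

HB.instance Definition _ :=
  CompleteNormedModule_isHilbert.Build R (ell2 R) (@ell2_inner_norm R).

End ell2_complete.

Section spaces.
Variables (R : realType) (H : hilbertType R).

Definition separable : Prop := exists2 D : set H, countable D & dense D.

Definition infinite_dimensional : Prop :=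
  ~ exists (n : nat) (e : 'I_n -> H), forall x : H,
      exists c : 'I_n -> R[i], x = \sum_(i < n) c i *: e i.

(* The order of R[i] compares two numbers only when they have the same
   imaginary part; here it is used on real-valued f. *)
Definition minimizer (f : H -> R[i]) (S : set H) (x : H) : Prop :=
  S x /\ forall y, S y -> f x <= f y.

End spaces.

Section operators.
Variable R : realType.
Implicit Types H K : hilbertType R.

Definition bounded_op H K (B : H -> K) : Prop :=
  linear B /\ exists M : R, forall x, `|B x| <= M%:C%C * `|x|.

(* adjoint, op_inv and mp_inverse below select the unique bounded operator with
   the stated property, and are the zero map if there is none. *)
Definition adjoint H K (B : H -> K) : K -> H :=
  xget (fun=> 0) [set C : K -> H | bounded_op C /\
    forall x y, inner (B x) y = inner x (C y)].

Definition is_inverse H K (B : H -> K) (C : K -> H) : Prop :=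
  [/\ bounded_op C, C \o B = id & B \o C = id].

Definition invertible_op H K (B : H -> K) : Prop := exists C, is_inverse B C.

Definition op_inv H K (B : H -> K) : K -> H := xget (fun=> 0) (is_inverse B).

Definition is_mp_inverse H K (B : H -> K) (C : K -> H) : Prop :=
  [/\ bounded_op C,
      B \o C = adjoint (B \o C),
      C \o B = adjoint (C \o B),
      B \o C \o B = B &
      C \o B \o C = C].

Definition mp_inverse H K (B : H -> K) : K -> H :=
  xget (fun=> 0) (is_mp_inverse B).

Definition positive_op H (T : H -> H) : Prop :=
  [/\ bounded_op T, adjoint T = T & forall x, 0 <= inner (T x) x].

Definition unitary_op H K (U : H -> K) : Prop :=
  [/\ bounded_op U, adjoint U \o U = id & U \o adjoint U = id].

Definition diagonal_op (k : R^nat) (D : ell2 R -> ell2 R) : Prop :=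
  forall (x : ell2 R) (n : nat), D x n = (k n)%:C%C * x n.

End operators.

(* Main.v *)
Require Import Defs.
From HB Require Import structures.
From mathcomp Require Import all_boot all_order all_algebra.
From mathcomp Require Import sesquilinear complex.
From mathcomp Require Import ring lra.
From mathcomp Require Import all_classical all_reals all_analysis.

Set Implicit Arguments.
Unset Strict Implicit.
Unset Printing Implicit Defensive.

Import Order.TTheory GRing.Theory Num.Theory.
Import numFieldNormedType.Exports.
Local Open Scope classical_set_scope.
Local Open Scope ring_scope.

(** Put [y = X (U x)]. Since [T = U^* X^2 U] and [X] is self-adjoint,
    [<x, T x> = |y|^2], and [A x = B y] for [B = A U^* X^-1]. The map
    [x |-> X (U x)] is a bijection, so the constrained problem amounts to finding
    the vector of least norm among the solutions of [B y = b]. The operator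
    [B^+ B] is the orthogonal projection along the kernel of [B], so every
    solution [y] satisfies [|y|^2 = |B^+ b|^2 + |y - B^+ b|^2]
    ([mp_pythagoras]): [B^+ b] is the unique solution of least norm, and going
    back through [x = U^* X^-1 y] gives the claim. The inverse of [X] exists as a
    bounded operator because [X^2], being unitarily equivalent to [T], is
    invertible ([invertible_sqrt]).

    What takes work is the existence of the bounded generalized inverse of a
    bounded operator [B] with closed range ([mp_inverse_exists]), that is, a
    bound [|x| <= M |B x|] on the orthogonal complement of the kernel
    ([ker_orth_bounded_below]). The vectors [z] of the range with
    [|B^* z| <= 1] define a pointwise bounded family of functionals, because
    [<B u, z> = <u, B^* z>]. By the uniform boundedness principle
    ([uniform_boundedness]) they are bounded, so [|z| <= M |B^* z|] on the range
    of [B] ([adjoint_bounded_below]). This makes the image of that range by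
    [B^*] closed, hence equal to the orthogonal complement of the kernel
    ([ker_orth_adjoint]). Finally, if [x = B^* z] then [|x|^2 = <B x, z>] is at
    most [|B x| M |x|].

    Adjoints come from the Riesz representation theorem ([riesz]), itself a
    consequence of the existence of orthogonal projections on closed subspaces
    ([projection_exists]). *)

(** * Real-valued norm and inner product *)

Section real_norm.
Variables (R : realType) (H : hilbertType R).
Implicit Types (x y z : H) (a : R[i]) (t : R).

(** The norm as an element of [R] rather than of [R[i]], where infima and
    archimedean arguments are available. *)
Definition rnorm x : R := complex.Re `|x|.

(** The real part of the inner product: a real inner product with the same norm. *)
Definition rinner x y : R := complex.Re (inner x y).

Lemma rnormE x : `|x| = (rnorm x)%:C%C.
Proof.
have := normr_ge0 x; rewrite lecE => /andP[/eqP Im0 _].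
by apply/eqP; rewrite eq_complex /= eqxx; apply/eqP.
Qed.

Lemma rnorm_ge0 x : 0 <= rnorm x.
Proof. by rewrite -lecR -rnormE; exact: normr_ge0. Qed.

Lemma rnorm_eq0 x : rnorm x = 0 -> x = 0.
Proof. by move=> x0; apply/eqP; rewrite -normr_eq0 rnormE x0. Qed.

Lemma rnorm0 : rnorm 0 = 0.
Proof. by rewrite /rnorm normr0. Qed.

Lemma rnormD x y : rnorm (x + y) <= rnorm x + rnorm y.
Proof. by rewrite -lecR rmorphD/= -!rnormE ler_normD. Qed.

Lemma rnormN x : rnorm (- x) = rnorm x.
Proof. by rewrite /rnorm normrN. Qed.

Lemma rnormBC x y : rnorm (x - y) = rnorm (y - x).
Proof. by rewrite /rnorm distrC. Qed.

Lemma rnorm_dist x y z : rnorm (x - z) <= rnorm (x - y) + rnorm (y - z).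
Proof. by rewrite -[x - z](subrKA y) rnormD. Qed.

Lemma rnormZ t x : rnorm (t%:C%C *: x) = `|t| * rnorm x.
Proof.
by rewrite /rnorm normrZ rnormE normc_def/= expr0n addr0 sqrtr_sqr mulr0 subr0.
Qed.

Lemma innerxx x : inner x x = (rnorm x ^+ 2)%:C%C.
Proof. by rewrite inner_norm rnormE rmorphXn. Qed.

Lemma innerC x y : inner x y = (inner y x)^*.
Proof. by rewrite hermC expr0 mul1r. Qed.

Lemma inner_scalel a x y : inner (a *: x) y = a * inner x y.
Proof. by rewrite linearZl_LR. Qed.

Lemma inner_scaler a x y : inner x (a *: y) = a^* * inner x y.
Proof. by rewrite linearZr_LR. Qed.

Lemma innerDl x y z : inner (x + y) z = inner x z + inner y z.
Proof. exact: linearDl. Qed.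

Lemma innerBl x y z : inner (x - y) z = inner x z - inner y z.
Proof. exact: linearBl. Qed.

Lemma innerDr x y z : inner z (x + y) = inner z x + inner z y.
Proof. exact: linearDr. Qed.

Lemma innerBr x y z : inner z (x - y) = inner z x - inner z y.
Proof. exact: linearBr. Qed.

Lemma rinnerxx x : rinner x x = rnorm x ^+ 2.
Proof. by rewrite /rinner innerxx. Qed.

Lemma rinnerC x y : rinner x y = rinner y x.
Proof. by rewrite /rinner innerC Defs.Re_conj. Qed.

Lemma rinnerDl x y z : rinner (x + y) z = rinner x z + rinner y z.
Proof. by rewrite /rinner innerDl raddfD. Qed.

Lemma rinnerDr x y z : rinner z (x + y) = rinner z x + rinner z y.
Proof. by rewrite /rinner innerDr raddfD. Qed.

Lemma rinnerNl x z : rinner (- x) z = - rinner x z.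
Proof. by rewrite /rinner linearNl raddfN. Qed.

Lemma rinnerNr x z : rinner z (- x) = - rinner z x.
Proof. by rewrite /rinner linearNr raddfN. Qed.

Lemma rinnerZl t x z : rinner (t%:C%C *: x) z = t * rinner x z.
Proof. by rewrite /rinner inner_scalel Re_mul/= mul0r subr0. Qed.

Lemma rinnerZr t x z : rinner z (t%:C%C *: x) = t * rinner z x.
Proof. by rewrite rinnerC rinnerZl rinnerC. Qed.

Lemma rnormD_sqr x y :
  rnorm (x + y) ^+ 2 = rnorm x ^+ 2 + 2 * rinner x y + rnorm y ^+ 2.
Proof.
by rewrite -!rinnerxx rinnerDl !rinnerDr (rinnerC y x); ring.
Qed.

Lemma rnormB_sqr x y :
  rnorm (x - y) ^+ 2 = rnorm x ^+ 2 - 2 * rinner x y + rnorm y ^+ 2.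
Proof. by rewrite rnormD_sqr rnormN rinnerNr mulrN. Qed.

Lemma parallelogram x y :
  rnorm (x + y) ^+ 2 + rnorm (x - y) ^+ 2 = 2 * rnorm x ^+ 2 + 2 * rnorm y ^+ 2.
Proof. by rewrite rnormD_sqr rnormB_sqr; ring. Qed.

Lemma inner_le x y : `|inner x y| <= (rnorm x * rnorm y)%:C%C.
Proof.
rewrite -ler_sqr ?nnegrE ?normr_ge0// ?ler0c ?mulr_ge0 ?rnorm_ge0//.
rewrite rmorphM/= exprMn -!rnormE -!inner_norm.
exact: (dot_CauchySchwarz (inner : {dot H for Num.conj})).
Qed.

Lemma rinner_le x y : `|rinner x y| <= rnorm x * rnorm y.
Proof.
have := dot_CauchySchwarz (inner : {dot H for Num.conj}) x y.
rewrite !innerxx -sqrncC -rmorphM/= lecR sqrncE => h.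
rewrite -ler_sqr ?nnegrE ?mulr_ge0 ?rnorm_ge0// exprMn real_normK ?num_real//.
by apply: le_trans h; rewrite lerDl sqr_ge0.
Qed.

(** Testing against the multiple of [y] by [inner x y] gives the squared modulus
    of [inner x y]. *)
Lemma inner_eq0 x y : (forall a, rinner x (a *: y) = 0) -> inner x y = 0.
Proof.
move=> /(_ (inner x y)); rewrite /rinner inner_scaler mulrC -normCK.
by rewrite -/(sqrnc _) => /eqP; rewrite sqrnc_eq0 => /eqP.
Qed.

Lemma inner_ext x y : (forall z, inner z x = inner z y) -> x = y.
Proof.
move=> /(_ (x - y)) xy; apply/eqP; rewrite -subr_eq0; apply/eqP.
apply: rnorm_eq0; apply/eqP; rewrite -sqrf_eq0 -rinnerxx /rinner.
by rewrite innerBr xy subrr.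
Qed.

(** Convergence, the Cauchy property and closedness for sequences, stated with the
    real-valued norm. *)
Definition hcvg (u : H^nat) l := forall e : R, 0 < e ->
  exists N, forall n, (N <= n)%N -> rnorm (u n - l) <= e.

Definition hcauchy (u : H^nat) := forall e : R, 0 < e ->
  exists N, forall m n, (N <= m)%N -> (N <= n)%N -> rnorm (u m - u n) <= e.

Lemma hcvg_cvg (u : H^nat) l : hcvg u l -> u @ \oo --> l.
Proof.
move=> ul; apply/cvgrPdist_le => _ /complex_gt0[e e0 ->].
have [N Nu] := ul e e0; exists N => // n /= Nn.
by rewrite distrC rnormE lecR Nu.
Qed.

Lemma cvg_hcvg (u : H^nat) l : u @ \oo --> l -> hcvg u l.
Proof.
move=> /cvgrPdist_le ul e e0; have [|N _ Nu] := ul e%:C%C; first by rewrite ltcR.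
by exists N => n Nn; rewrite -lecR -rnormE distrC; exact: Nu.
Qed.

Lemma hcauchy_hcvg (u : H^nat) : hcauchy u -> exists l, hcvg u l.
Proof.
move=> cu; have : cvgn u.
  apply: cauchy_cvg; apply/cauchy_ballP => _ /complex_gt0[e e0 ->].
  have [N Nu] := cu (e / 2) (divr_gt0 e0 (ltr0Sn R 1)).
  pose tail := [set u n | n in [set n | (N <= n)%N]].
  exists (tail, tail); first by split; exists N => // n Nn; exists n.
  move=> [_ _]/= [[m Nm <-] [n Nn <-]]; rewrite -ball_normE/= rnormE ltcR.
  by apply: (le_lt_trans (Nu _ _ Nm Nn)); rewrite ltr_pdivrMr// ltr_pMr// ltr1n.
by move=> /cvg_ex[l ul]; exists l; exact: cvg_hcvg.
Qed.

Lemma hcvg_unique (u : H^nat) l m : hcvg u l -> hcvg u m -> l = m.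
Proof.
by move=> /hcvg_cvg ul /hcvg_cvg um; exact: cvg_unique ul um.
Qed.

Definition hclosed (N : set H) :=
  forall (u : H^nat) l, (forall n, N (u n)) -> hcvg u l -> N l.

Lemma closed_hclosed (N : set H) : closed N -> hclosed N.
Proof.
move=> cN u l Nu /hcvg_cvg ul; apply: (closed_cvg _ cN _ l ul).
exact: nearW.
Qed.

(** Complex linear subspaces, as sets. *)
Definition is_subspace (N : set H) :=
  N 0 /\ forall a x y, N x -> N y -> N (a *: x + y).

End real_norm.

(** * Orthogonal projection on a closed subspace *)

Lemma invS_le (R : realType) (e : R) : 0 < e ->
  exists M, forall n, (M <= n)%N -> (n.+1%:R)^-1 <= e.
Proof.
move=> e0; exists (Num.bound e^-1) => n Mn.
rewrite -[e]invrK lef_pV2 ?posrE ?invr_gt0//.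
apply/ltW/(lt_le_trans (archi_boundP _)); first by rewrite invr_ge0 ltW.
by rewrite ler_nat leqW.
Qed.

Lemma le0_small (R : realType) (M r : R) :
  (forall e, 0 < e -> r <= M * e) -> r <= 0.
Proof.
move=> rM; rewrite leNgt; apply/negP => r0.
have M0 : 0 < M by apply: (lt_le_trans r0); rewrite -[M]mulr1 rM.
have := rM (r / (2 * M)); rewrite divr_gt0 ?mulr_gt0// => /(_ isT).
rewrite (_ : M * _ = r / 2); last by field; rewrite gt_eqF.
lra.
Qed.

Section projection.
Variables (R : realType) (H : hilbertType R) (N : set H).
Hypothesis sN : is_subspace N.
Implicit Types (x y z : H) (a : R[i]) (t : R).

Lemma subspaceZ a x : N x -> N (a *: x).
Proof. by case: sN => N0 NP Nx; rewrite -[_ *: _]addr0; exact: NP. Qed.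

Lemma subspaceD x y : N x -> N y -> N (x + y).
Proof. by case: sN => N0 NP Nx Ny; rewrite -[x]scale1r; exact: NP. Qed.

Lemma subspaceB x y : N x -> N y -> N (x - y).
Proof.
by move=> Nx Ny; apply: subspaceD => //; rewrite -scaleN1r; exact: subspaceZ.
Qed.

(** A point whose distance to [x] does not exceed that of any other point of
    the subspace is the foot of the perpendicular from [x]. *)
Lemma nearest_orthogonal x p : N p ->
  (forall y, N y -> rnorm (x - p) <= rnorm (x - y)) ->
  forall y, N y -> inner (x - p) y = 0.
Proof.
move=> Np pmin; suff rort y : N y -> rinner (x - p) y = 0.
  by move=> y Ny; apply: inner_eq0 => a; apply: rort; exact: subspaceZ.
move=> Ny; set r := rinner _ _; set s := rnorm y ^+ 2.
have s0 : 0 <= s by exact: sqr_ge0.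
(* p + (r / s) y is the point nearest to x on the line through p directed by y;
   the step r / (s + 1) also decreases the distance unless r = 0, and makes
   sense when y = 0 *)
pose t := r / (s + 1).
have := pmin _ (subspaceD Np (subspaceZ (t%:C)%C Ny)).
rewrite -ler_sqr ?nnegrE ?rnorm_ge0// opprD addrA (rnormB_sqr (x - p)) rinnerZr rnormZ.
rewrite exprMn real_normK ?num_real// -/r -/s => h.
have ts : t * (s + 1) = r by rewrite divfK// gt_eqF// ltr_wpDl.
have t2 : t ^+ 2 * (s + 2) <= 0.
  by rewrite -ts in h; nra.
have /eqP : t ^+ 2 = 0.
  apply/eqP; rewrite eq_le sqr_ge0 andbT.
  by rewrite -(pmulr_lle0 (x := s + 2)) // ltr_wpDl.
by rewrite sqrf_eq0 -ts => /eqP ->; rewrite mul0r.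
Qed.

(** A minimizing sequence for the distance is Cauchy by the parallelogram
    identity. *)
Lemma projection_exists x : hclosed N ->
  exists2 p, N p & forall y, N y -> inner (x - p) y = 0.
Proof.
move=> cN; pose E := [set rnorm (x - y) ^+ 2 | y in N].
have lE : lbound E 0 by move=> _ [y _ <-]; exact: sqr_ge0.
have iE : has_inf E.
  by split; [exists (rnorm (x - 0) ^+ 2); exists 0 => //; case: sN|exists 0].
have ED y : N y -> inf E <= rnorm (x - y) ^+ 2.
  by move=> Ny; apply: ge_inf; [exists 0|exists y].
have /choice[p pP] n : exists y, N y /\ rnorm (x - y) ^+ 2 <= inf E + n.+1%:R^-1.
  have [|_ [y Ny <-] ylt] := @inf_adherent _ E n.+1%:R^-1 _ iE.
    by rewrite invr_gt0.
  by exists y; split => //; exact: ltW.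
have [l pl] : exists l, hcvg p l.
  apply: hcauchy_hcvg => e e0.
  have [|M MP] := @invS_le R (e ^+ 2 / 4); first by rewrite divr_gt0// exprn_gt0.
  exists M => m n /MP hm /MP hn.
  have [[Nm pm] [Nn pn]] := (pP m, pP n).
  have := ED _ (subspaceZ (2^-1)%:C%C (subspaceD Nm Nn)).
  have := parallelogram (x - p m) (x - p n).
  have -> : x - p m + (x - p n) = 2%:C%C *: (x - 2^-1%:C%C *: (p m + p n)).
    rewrite scalerBr scalerA -rmorphM/= mulfV// scale1r.
    by rewrite -[2]/(1 + 1 : R) rmorphD scalerDl scale1r opprD addrACA.
  rewrite (_ : x - p m - (x - p n) = p n - p m); last first.
    by rewrite opprB addrC addrA subrK.
  rewrite rnormZ ger0_norm// exprMn (rnormBC (p m)) => h1 h2.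
  rewrite -ler_sqr ?nnegrE ?rnorm_ge0 ?(ltW e0)//.
  move: h1 h2 hm hn pm pn; move: (rnorm _) (rnorm _) (rnorm _) (rnorm _).
  move: m.+1%:R^-1 n.+1%:R^-1 => i j a b c d h1 h2 hm hn pm pn.
  by move: h1 h2 hm hn pm pn; rewrite !expr2 => *; lra.
have Nl : N l by apply: (cN p) => // n; case: (pP n).
have xl : rnorm (x - l) ^+ 2 <= inf E.
  rewrite leNgt; apply/negP => lt.
  have iE0 : 0 <= inf E by apply: lb_le_inf => //; case: iE.
  set s := rnorm (x - l) in lt.
  have s0 : 0 <= s by exact: rnorm_ge0.
  (* the points p n, close to l, would be at a squared distance from x exceeding
     the infimum by at least d / 2, while d / 4 is allowed for large n *)
  pose d := s ^+ 2 - inf E.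
  have d0 : 0 < d by rewrite subr_gt0.
  have [M1 M1P] := @invS_le R (d / 4) (divr_gt0 d0 (ltr0Sn _ _)).
  pose e := d / (4 * (s + 1)).
  have e0 : 0 < e by rewrite divr_gt0// mulr_gt0// ltr_wpDl.
  have ed : e * (4 * (s + 1)) = d.
    by rewrite divfK// gt_eqF// mulr_gt0// ltr_wpDl.
  have [M2 M2P] := pl e e0.
  have h1 := M1P (maxn M1 M2) (leq_maxl _ _).
  have h2 := M2P (maxn M1 M2) (leq_maxr _ _).
  have [_ h3] := pP (maxn M1 M2).
  have := rnorm_dist x (p (maxn M1 M2)) l; rewrite -/s.
  have := rnorm_ge0 (x - p (maxn M1 M2)).
  move: h1 h2 h3; move: (rnorm _) (rnorm _) (_^-1) => u v w h1 h2 h3 v0 h4.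
  have sd : d <= s ^+ 2 by rewrite /d gerBl.
  have : s - e <= u by lra.
  have es : e <= s by nra.
  move=> sev; have : (s - e) ^+ 2 <= u ^+ 2 by rewrite ler_sqr ?nnegrE// subr_ge0.
  rewrite /d in ed d0 h1; nra.
exists l => //; apply: nearest_orthogonal => // y Ny.
rewrite -ler_sqr ?nnegrE ?rnorm_ge0//; exact: le_trans xl (ED _ Ny).
Qed.

End projection.

(** * The Riesz representation theorem *)

Section riesz.
Variables (R : realType) (H : hilbertType R) (f : H -> R[i]) (M : R).
Hypothesis f_linear : forall a x y, f (a *: x + y) = a * f x + f y.
Hypothesis f_bounded : forall x, `|f x| <= (M * rnorm x)%:C%C.

Let f0 : f 0 = 0.
Proof. by have := f_linear (-1) 0 0; rewrite scaler0 addr0 mulN1r addNr. Qed.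

Let fB x y : f (x - y) = f x - f y.
Proof. by rewrite addrC -scaleN1r f_linear mulN1r addrC. Qed.

Let ker_subspace : is_subspace [set x | f x = 0].
Proof. by split=> //= a x y fx fy; rewrite f_linear fx fy mulr0 addr0. Qed.

Let ker_closed : hclosed [set x | f x = 0].
Proof.
move=> u l fu ul /=.
have fl : `|f l| = (complex.Re `|f l|)%:C%C.
  have := normr_ge0 (f l); rewrite lecE => /andP[/eqP Im0 _].
  by apply/eqP; rewrite eq_complex /= eqxx; apply/eqP.
apply/eqP; rewrite -normr_le0 fl lecR; apply: (@le0_small _ `|M|) => e e0.
have [N Nu] := ul e e0; rewrite -lecR -fl.
have -> : f l = f (l - u N) by rewrite fB [f (u N)]fu subr0.
apply: le_trans (f_bounded _) _; rewrite lecR rnormBC.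
apply: le_trans (ler_wpM2r (rnorm_ge0 _) (ler_norm M)) _.
by rewrite ler_wpM2l// Nu.
Qed.

(** The kernel of a nonzero [f] has a nonzero orthogonal vector [v]; every
    [x - (f x / f v) *: v] lies in the kernel, so a multiple of [v] represents
    [f]. *)
Lemma riesz : exists z, forall x, f x = inner x z.
Proof.
have [[u fu]|/forallNP fN] := pselect (exists u, f u <> 0); last first.
  exists 0 => x; rewrite linear0r; apply/eqP; move: (fN x) => /contrapT ->.
  by rewrite eqxx.
have [p fp up] := projection_exists ker_subspace u ker_closed.
set v := u - p in up; have fv : f v != 0.
  by rewrite /v fB [f p]fp subr0; apply/eqP.
have v0 : inner v v != 0.
  apply: contra_neq fv => /eqP; rewrite innerxx => /eqP v0.
  suff -> : v = 0 by [].
  apply: rnorm_eq0; apply/eqP; rewrite -sqrf_eq0.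
  by have := congr1 (@complex.Re R) v0 => /= ->.
exists ((f v / inner v v)^* *: v) => x.
have : inner (x - (f x / f v) *: v) v = 0.
  rewrite innerC up ?conjC0//= fB.
  by rewrite -[_ *: v]addr0 f_linear f0 addr0 divfK// subrr.
rewrite innerBl inner_scalel inner_scaler conjCK => /eqP; rewrite subr_eq0.
by move=> /eqP ->; field; rewrite fv v0.
Qed.

End riesz.

(** * Bounded operators and adjoints *)

Section bounded_operators.
Variable R : realType.
Implicit Types H K L : hilbertType R.

Lemma linear_op0 H K (B : H -> K) : linear B -> B 0 = 0.
Proof. by move=> lB; have := lB (-1) 0 0; rewrite scaler0 addr0 scaleN1r addNr. Qed.

Lemma linear_opZ H K (B : H -> K) : linear B -> forall a, {morph B : x / a *: x}.
Proof. by move=> lB a x; rewrite -[a *: x]addr0 lB linear_op0// addr0. Qed.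

Lemma linear_opB H K (B : H -> K) : linear B -> {morph B : x y / x - y}.
Proof. by move=> lB x y; rewrite addrC -scaleN1r lB scaleN1r addrC. Qed.

Lemma bounded_opP H K (B : H -> K) : bounded_op B <->
  linear B /\ exists2 M, 0 < M & forall x, rnorm (B x) <= M * rnorm x.
Proof.
split=> -[lB [M]].
  move=> BM; split => //; exists (`|M| + 1); first by rewrite ltr_wpDl.
  move=> x; have := BM x; rewrite !rnormE -rmorphM lecR => /le_trans; apply.
  rewrite ler_wpM2r ?rnorm_ge0//; apply: le_trans (ler_norm M) _.
  by rewrite lerDl.
by move=> M0 BM; split=> //; exists M => x; rewrite !rnormE -rmorphM lecR.
Qed.

Lemma bounded_op_comp H K L (B : K -> L) (C : H -> K) :
  bounded_op B -> bounded_op C -> bounded_op (B \o C).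
Proof.
move=> /bounded_opP[lB [M M0 BM]] /bounded_opP[lC [M' M'0 CM]].
apply/bounded_opP; split=> [a x y /=|]; first by rewrite lC lB.
exists (M * M') => [|x /=]; first exact: mulr_gt0.
by apply: le_trans (BM _) _; rewrite -mulrA ler_wpM2l ?(ltW M0).
Qed.

Lemma bounded_op_cvg H K (B : H -> K) u l :
  bounded_op B -> hcvg u l -> hcvg (B \o u) (B l).
Proof.
move=> /bounded_opP[lB [M M0 BM]] ul e e0.
have [N Nu] := ul (e / M) (divr_gt0 e0 M0); exists N => n Nn /=.
rewrite -linear_opB//; apply: le_trans (BM _) _.
by rewrite mulrC -ler_pdivlMr// Nu.
Qed.

Lemma adjoint_unique H K (B : H -> K) (C D : K -> H) :
  (forall x y, inner (B x) y = inner x (C y)) ->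
  (forall x y, inner (B x) y = inner x (D y)) -> C = D.
Proof.
move=> BC BD; apply/funext => y; apply: inner_ext => x.
by rewrite -BC -BD.
Qed.

Lemma adjoint_exists H K (B : H -> K) : bounded_op B ->
  exists C : K -> H, bounded_op C /\ forall x y, inner (B x) y = inner x (C y).
Proof.
move=> /bounded_opP[lB [M M0 BM]].
have /choice[C CP] y : exists z, forall x, inner (B x) y = inner x z.
  apply: (@riesz _ _ _ (M * rnorm y)) => [a x z|x].
    by rewrite lB innerDl inner_scalel.
  apply: le_trans (inner_le _ _) _; rewrite lecR mulrAC ler_wpM2r ?rnorm_ge0//.
have CP' x y : inner (B x) y = inner x (C y) by [].
exists C; split => //; apply/bounded_opP; split.
  move=> a y z; apply: inner_ext => x.
  by rewrite -CP' !innerDr !inner_scaler !CP'.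
exists M => // y.
have h : rnorm (C y) ^+ 2 <= M * rnorm (C y) * rnorm y.
  rewrite -rinnerxx /rinner -CP' -/(rinner _ _).
  apply: le_trans (ler_norm _) _; apply: le_trans (rinner_le _ _) _.
  by rewrite ler_wpM2r ?rnorm_ge0.
have := rnorm_ge0 (C y); rewrite le_eqVlt => /predU1P[<-|Cy0].
  by rewrite mulr_ge0 ?rnorm_ge0 ?(ltW M0).
by rewrite -(ler_pM2l Cy0) -expr2 (le_trans h)// mulrCA mulrA.
Qed.

Lemma adjointP H K (B : H -> K) : bounded_op B ->
  bounded_op (adjoint B) /\ forall x y, inner (B x) y = inner x (adjoint B y).
Proof. by move=> /adjoint_exists/(xgetPex (fun=> 0)). Qed.

Lemma adjointE H K (B : H -> K) (C : K -> H) : bounded_op B ->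
  (forall x y, inner (B x) y = inner x (C y)) -> adjoint B = C.
Proof. by move=> /adjointP[_ BB] BC; exact: adjoint_unique BB BC. Qed.

End bounded_operators.

(** * The uniform boundedness principle *)

Section uniform_boundedness.
Variables (R : realType) (H : hilbertType R) (F : set H).

(** Uniform boundedness principle for the functionals [rinner ^~ z], [z] in [F],
    by a gliding hump: if [F] is unbounded, a series of steps of norms [3 ^- n]
    along vectors [z n] of [F] of fast growing norms, each with the sign that
    makes it add to the absolute value of the pairing with [z n], converges to a point at which [F]
    is not pointwise bounded. The steps after the [n]th one contribute at most
    half of what this step does. *)
Lemma uniform_boundedness :
  (forall x, exists M : R, forall z, F z -> `|rinner x z| <= M) ->
  exists M, forall z, F z -> rnorm z <= M.
Proof.
move=> ptF; apply: contrapT => /forallNP unF.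
pose d n : R := 3 ^- n.
have d0 n : 0 < d n by rewrite invr_gt0 exprn_gt0.
have dS n : d n.+1 = d n / 3 by rewrite /d exprSr invfM.
have d_le n : d n <= n.+1%:R^-1.
  rewrite lef_pV2 ?posrE ?exprn_gt0// -natrX ler_nat; exact: ltn_expl.
have /choice[z zP] n : exists z, F z /\ 2 * n.+1%:R / d n < rnorm z.
  have /existsNP[z /not_implyP[Fz /negP]] := unF (2 * n.+1%:R / d n).
  by rewrite -ltNge; exists z.
have z0 n : 0 < rnorm (z n).
  by apply: lt_trans (zP n).2; rewrite divr_gt0// mulr_gt0.
pose s u n : R := if 0 <= rinner u (z n) then 1 else -1.
have s1 u n : `|s u n| = 1 by rewrite /s; case: ifP; rewrite ?normrN normr1.
pose step u n := (s u n * (d n / rnorm (z n)))%:C%C *: z n.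
pose x := nat_rect (fun=> H) 0 (fun n u => u + step u n).
have xS n : x n.+1 = x n + step (x n) n by [].
have step_norm u n : rnorm (step u n) = d n.
  rewrite rnormZ normrM s1 mul1r ger0_norm ?divr_ge0 ?(ltW (d0 _)) ?rnorm_ge0//.
  by rewrite divfK// gt_eqF.
have xz n : d n * rnorm (z n) <= `|rinner (x n.+1) (z n)|.
  rewrite xS rinnerDl rinnerZl rinnerxx.
  rewrite (_ : _ * rnorm (z n) ^+ 2 = s (x n) n * (d n * rnorm (z n))); last first.
    by rewrite -mulrA expr2 (mulrA (_ / _)) divfK// gt_eqF.
  have := mulr_gt0 (d0 n) (z0 n); rewrite /s; case: ifPn => [r0 dz|].
    by rewrite mul1r ger0_norm ?addr_ge0 ?(ltW dz)// lerDr.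
  rewrite -ltNge => r0 dz; rewrite mulN1r ler0_norm; last lra.
  by lra.
have dist n m : rnorm (x (n + m)%N - x n) <= 3 / 2 * (d n - d (n + m)%N).
  elim: m => [|m IH]; first by rewrite addn0 !subrr rnorm0 mulr0.
  rewrite addnS; apply: le_trans (rnorm_dist _ (x (n + m)%N) _) _.
  rewrite {1}xS [_ + step _ _]addrC addrK step_norm dS.
  by move: IH; set a := rnorm _; lra.
have dist_le n m : (n <= m)%N -> rnorm (x m - x n) <= 3 / 2 * d n.
  move=> nm; have := dist n (m - n)%N; rewrite subnKC// => /le_trans; apply.
  by have := d0 m; lra.
have [l xl] : exists l, hcvg x l.
  apply: hcauchy_hcvg => e e0.
  have [N NP] := @invS_le R (e / 3) (divr_gt0 e0 (ltr0Sn _ _)).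
  have dN : d N <= e / 3 := le_trans (d_le N) (NP N (leqnn N)).
  exists N => m n Nm Nn; apply: le_trans (rnorm_dist _ (x N) _) _.
  have := dist_le _ _ Nm; have := dist_le _ _ Nn; rewrite (rnormBC (x n)).
  by move: (rnorm _) (rnorm _) => a b; lra.
have xl_le n : rnorm (x n - l) <= 3 / 2 * d n.
  apply/ler_addgt0Pr => e e0; have [N NP] := xl e e0.
  apply: le_trans (rnorm_dist _ (x (maxn N n)) _) _.
  have := dist_le _ _ (leq_maxr N n); have := NP _ (leq_maxl N n).
  by rewrite (rnormBC (x n)); move: (rnorm _) (rnorm _) => a b; lra.
have [M MP] := ptF l; pose n := Num.bound `|M|.
have Mn : M < n.+1%:R.
  apply: le_lt_trans (ler_norm M) _.
  by apply: lt_le_trans (archi_boundP _) _ => //; rewrite ler_nat /n; exact: leqW.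
have [Fz zn] := zP n; have := MP _ Fz.
have := xz n; have := rinner_le (x n.+1 - l) (z n); have := xl_le n.+1.
have : rinner (x n.+1) (z n) = rinner l (z n) + rinner (x n.+1 - l) (z n).
  by rewrite rinnerDl rinnerNl addrC subrK.
move=> ->; rewrite dS; move: zn; rewrite ltr_pdivrMr// => zn.
set a := rnorm (z n) in zn *; set b := rnorm (_ - l); set c := d n in zn *.
set p := rinner l _; set q := rinner _ _ => bc qb pq pM.
have a0 : 0 < a by exact: z0.
have : `|p + q| <= `|p| + `|q| := ler_normD _ _.
have : b * a <= 3 / 2 * (c / 3) * a by rewrite ler_wpM2r// ltW.
by move: `|p| `|q| `|p + q| pM qb pq => *; nra.
Qed.

End uniform_boundedness.

(** * The generalized inverse of a bounded operator with closed range *)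

Section moore_penrose.
Variables (R : realType) (H K : hilbertType R) (B : H -> K).
Hypothesis B_bounded : bounded_op B.

Let B_linear : linear B := B_bounded.1.

Lemma range_subspace : is_subspace (range B).
Proof.
split=> [|a _ _ [x _ <-] [y _ <-]]; first by exists 0 => //; exact: linear_op0.
by exists (a *: x + y) => //; exact: B_linear.
Qed.

Lemma ker_subspace : is_subspace [set x | B x = 0].
Proof.
split=> [|a x y /= Bx By]; first exact: linear_op0.
by rewrite B_linear Bx By scaler0 addr0.
Qed.

Lemma ker_closed : hclosed [set x | B x = 0].
Proof.
move=> u l Bu /(bounded_op_cvg B_bounded) Bul /=.
apply: hcvg_unique Bul _ => e e0; exists 0%N => n _ /=.
by rewrite [B (u n)]Bu subrr rnorm0 ltW.
Qed.

(** Orthogonality to the kernel of [B]. *)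
Definition ker_orth (x : H) := forall y, B y = 0 -> inner x y = 0.

Lemma ker_orth_eq0 x : ker_orth x -> B x = 0 -> x = 0.
Proof.
move=> xort /xort x0; apply: rnorm_eq0; apply/eqP.
by rewrite -sqrf_eq0 -rinnerxx /rinner x0.
Qed.

Lemma ker_orthP a x y : ker_orth x -> ker_orth y -> ker_orth (a *: x + y).
Proof.
by move=> xo yo z Bz; rewrite innerDl inner_scalel xo// yo// mulr0 addr0.
Qed.

Lemma range_orth_eq0 y :
  range B y -> (forall z, range B z -> inner y z = 0) -> y = 0.
Proof.
move=> By /(_ _ By) y0; apply: rnorm_eq0; apply/eqP.
by rewrite -sqrf_eq0 -rinnerxx /rinner y0.
Qed.

Lemma rinner_adjoint x y : rinner (B x) y = rinner x (adjoint B y).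
Proof. by rewrite /rinner; congr complex.Re; have [_ ->] := adjointP B_bounded. Qed.

Hypothesis B_closed : hclosed (range B).

(** The vectors of the range that the adjoint maps into the unit ball are
    pointwise bounded: against [B u] they pair to at most [rnorm u], and vectors
    orthogonal to the range do not see them. *)
Lemma adjoint_bounded_below : exists2 M : R, 0 < M &
  forall z, range B z -> rnorm z <= M * rnorm (adjoint B z).
Proof.
have [[lA _] _] := adjointP B_bounded.
have [x|M FM] := @uniform_boundedness _ _
    [set z | range B z /\ rnorm (adjoint B z) <= 1].
  have [_ [u _ <-] uP] := projection_exists range_subspace x B_closed.
  exists (rnorm u) => z [Bz z1].
  have -> : rinner x z = rinner (B u) z.
    apply/eqP; rewrite -subr_eq0 -rinnerNl -rinnerDl; apply/eqP.
    by rewrite /rinner uP.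
  rewrite rinner_adjoint; apply: le_trans (rinner_le _ _) _.
  by rewrite -[leRHS]mulr1 ler_wpM2l ?rnorm_ge0.
exists (`|M| + 1) => [|z Bz]; first by rewrite ltr_wpDl.
have := rnorm_ge0 (adjoint B z); rewrite le_eqVlt => /predU1P[/esym z0|z0].
  case: Bz => u _ uz; suff -> : z = 0 by rewrite rnorm0 mulr_ge0 ?rnorm_ge0// addr_ge0.
  apply: rnorm_eq0; apply/eqP; rewrite -sqrf_eq0 -rinnerxx -{1}uz rinner_adjoint.
  by rewrite (rnorm_eq0 z0) /rinner linear0r.
have := FM ((rnorm (adjoint B z))^-1%:C%C *: z).
rewrite /= linear_opZ// !rnormZ ger0_norm ?invr_ge0 ?rnorm_ge0//.
rewrite mulVf ?gt_eqF// => h.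
have {h} : (rnorm (adjoint B z))^-1 * rnorm z <= M.
  by apply: h; split=> //; exact: (subspaceZ range_subspace).
rewrite mulrC ler_pdivrMr// => /le_trans; apply.
by rewrite ler_wpM2r ?rnorm_ge0//; apply: le_trans (ler_norm _) _; rewrite lerDl.
Qed.

(** The image by the adjoint of the range of [B] is closed, by the lower bound
    above, hence it is the whole orthogonal complement of the kernel of [B]. *)
Lemma ker_orth_adjoint x :
  ker_orth x -> exists2 z, range B z & x = adjoint B z.
Proof.
move=> xort; have [M M0 BM] := adjoint_bounded_below.
have [bA BA] := adjointP B_bounded; have lA := bA.1.
pose W := [set adjoint B z | z in range B].
have sW : is_subspace W.
  split=> [|a _ _ [x1 Bx1 <-] [x2 Bx2 <-]].
    by exists 0; [exact: range_subspace.1|exact: linear_op0].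
  by exists (a *: x1 + x2); [exact: range_subspace.2|exact: lA].
have cW : hclosed W.
  move=> w l Ww wl.
  have /choice[z zP] n : exists z, range B z /\ adjoint B z = w n.
    by have [z Bz zw] := Ww n; exists z.
  have [v zv] : exists v, hcvg z v.
    apply: hcauchy_hcvg => e e0.
    have [N NP] := wl (e / (2 * M)) (divr_gt0 e0 (mulr_gt0 (ltr0Sn R 1) M0)).
    exists N => m n Nm Nn.
    apply: le_trans (BM _ _) _.
      apply: (subspaceB range_subspace); exact: (zP _).1.
    rewrite linear_opB// !(zP _).2.
    have : rnorm (w m - w n) <= e / (2 * M) + e / (2 * M).
      apply: le_trans (rnorm_dist _ l _) _.
      by rewrite lerD ?NP// rnormBC NP.
    move=> /(ler_wpM2l (ltW M0)) /le_trans; apply.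
    by rewrite le_eqVlt; apply/orP; left; apply/eqP; field; rewrite gt_eqF.
  exists v; first by apply: (B_closed _ zv) => n; exact: (zP n).1.
  apply: hcvg_unique (bounded_op_cvg bA zv) _.
  by rewrite (_ : _ \o _ = w)//; apply/funext => n /=; exact: (zP n).2.
have [_ [z Bz <-] zP] := projection_exists sW x cW.
exists z => //; apply/eqP; rewrite -subr_eq0; apply/eqP.
have Bx0 : B (x - adjoint B z) = 0.
  apply: range_orth_eq0; first by eexists.
  by move=> y By; rewrite BA zP//; exists y.
apply: ker_orth_eq0 => // y By; rewrite innerBl xort// sub0r.
by rewrite innerC -BA By linear0l conjC0 oppr0.
Qed.

Lemma ker_orth_bounded_below : exists2 M : R, 0 < M &
  forall x, ker_orth x -> rnorm x <= M * rnorm (B x).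
Proof.
have [M M0 BM] := adjoint_bounded_below; exists M => // x xort.
have := rnorm_ge0 x; rewrite le_eqVlt => /predU1P[<-|x0].
  by rewrite mulr_ge0 ?rnorm_ge0// ltW.
have [z Bz xz] := ker_orth_adjoint xort.
rewrite -(ler_pM2l x0) -expr2 -{1}rinnerxx {2}xz -rinner_adjoint.
apply: le_trans (ler_norm _) _; apply: le_trans (rinner_le _ _) _.
have := BM _ Bz; rewrite -xz => /(ler_wpM2l (rnorm_ge0 (B x))) /le_trans; apply.
by rewrite le_eqVlt; apply/orP; left; apply/eqP; ring.
Qed.

(** The generalized inverse maps [y] to the solution, orthogonal to the kernel,
    of [B x = p], where [p] is the orthogonal projection of [y] on the range. *)
Lemma mp_inverse_exists : exists C, is_mp_inverse B C.
Proof.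
have /choice[C CP] y : exists x, ker_orth x /\
    forall z, range B z -> inner (y - B x) z = 0.
  have [_ [u _ <-] uP] := projection_exists range_subspace y B_closed.
  have [q Bq qP] := projection_exists ker_subspace u ker_closed.
  by exists (u - q); split=> //; rewrite linear_opB// [B q]Bq subr0.
have Cort y : ker_orth (C y) := (CP y).1.
have Cproj y z : range B z -> inner (B (C y)) z = inner y z.
  move=> Bz; apply/eqP; rewrite eq_sym -subr_eq0 -innerBl; apply/eqP.
  exact: (CP y).2.
have rB x : range B (B x) by exists x.
have BCB x : B (C (B x)) = B x.
  apply/eqP; rewrite -subr_eq0 -linear_opB//; apply/eqP.
  apply: range_orth_eq0 => // z Bz.
  by rewrite linear_opB// innerBl Cproj// subrr.
have Ceq x y : ker_orth x -> B x = B (C y) -> C y = x.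
  move=> xo Bxy; apply/eqP; rewrite eq_sym -subr_eq0; apply/eqP.
  apply: ker_orth_eq0; last by rewrite linear_opB// Bxy subrr.
  by rewrite addrC -scaleN1r; exact: ker_orthP.
have bC : bounded_op C.
  apply/bounded_opP; split.
    move=> a x y; apply: Ceq; first exact: ker_orthP.
    apply/eqP; rewrite -subr_eq0 -linear_opB//; apply/eqP.
    apply: range_orth_eq0 => // z Bz.
    rewrite linear_opB// B_linear innerBl innerDl inner_scalel !Cproj//.
    by rewrite innerDl inner_scalel subrr.
  have [M M0 BM] := ker_orth_bounded_below; exists M => // y.
  apply: le_trans (BM _ (Cort y)) _; rewrite ler_wpM2l ?(ltW M0)//.
  have := rnorm_ge0 (B (C y)); rewrite le_eqVlt => /predU1P[<-|y0].
    exact: rnorm_ge0.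
  rewrite -(ler_pM2r y0) -expr2 -rinnerxx /rinner Cproj//.
  exact: le_trans (ler_norm _) (rinner_le _ _).
exists C; split=> //.
- apply/esym/adjointE; first exact: bounded_op_comp.
  move=> x y /=; rewrite innerC -Cproj// -innerC.
  by rewrite Cproj.
- apply/esym/adjointE; first exact: bounded_op_comp.
  have CBproj x y : inner (C (B x)) y = inner (C (B x)) (C (B y)).
    apply/eqP; rewrite -subr_eq0 -innerBr; apply/eqP; apply: Cort.
    by rewrite linear_opB// BCB subrr.
  by move=> x y /=; rewrite CBproj innerC -CBproj -innerC.
- by apply/funext => x /=.
- apply/funext => y /=; apply: Ceq => //; exact/esym/BCB.
Qed.

End moore_penrose.

(** * Solutions of least norm *)

Section least_norm.
Variables (R : realType) (H K : hilbertType R) (B : H -> K) (C : K -> H).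
Hypotheses (B_bounded : bounded_op B) (BC : is_mp_inverse B C).

Lemma mp_solution b : range B b -> B (C b) = b.
Proof.
by case: BC => _ _ _ BCB _ [x _ <-]; have := congr1 (@^~ x) BCB.
Qed.

(** [C (B x)] is orthogonal to the kernel, which contains [x - C (B x)]. *)
Lemma mp_pythagoras x :
  rnorm x ^+ 2 = rnorm (C (B x)) ^+ 2 + rnorm (x - C (B x)) ^+ 2.
Proof.
case: BC => bC _ CB BCB CBC; set c := C (B x).
have bCB : bounded_op (C \o B) by exact: bounded_op_comp.
have Bxc : B (x - c) = 0.
  rewrite (linear_opB B_bounded.1) /c.
  by have /= -> := congr1 (@^~ x) BCB; rewrite subrr.
have cE : C (B c) = c by have := congr1 (@^~ (B x)) CBC.
have cort : inner c (x - c) = 0.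
  have [_ CBP] := adjointP bCB.
  by rewrite -{1}cE [LHS](CBP c) -CB /= Bxc (linear_op0 bC.1) linear0r.
have := rnormD_sqr c (x - c).
by rewrite (addrC c) subrK /rinner cort/= mulr0 addr0.
Qed.

End least_norm.

(** * The minimization problem *)

Lemma op_invP (R : realType) (H K : hilbertType R) (B : H -> K) :
  invertible_op B -> is_inverse B (op_inv B).
Proof. exact: xgetPex. Qed.

Lemma mp_inverseP (R : realType) (H K : hilbertType R) (B : H -> K) :
  bounded_op B -> hclosed (range B) -> is_mp_inverse B (mp_inverse B).
Proof. by move=> bB cB; apply: xgetPex; exact: mp_inverse_exists. Qed.

(** A bounded square root of an invertible operator is invertible, since it
    commutes with its square. *)
Lemma invertible_sqrt (R : realType) (H : hilbertType R) (X S : H -> H) :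
  bounded_op X -> X \o X = S -> invertible_op S -> invertible_op X.
Proof.
move=> bX XX [Y [bY YS SY]]; exists (X \o Y).
have YXX x : Y (X (X x)) = x by have := congr1 (@^~ x) YS; rewrite -XX.
have XXY x : X (X (Y x)) = x by have := congr1 (@^~ x) SY; rewrite -XX.
split; [exact: bounded_op_comp| |exact/funext].
by apply/funext => x /=; rewrite -[LHS]YXX XXY YXX.
Qed.

Theorem theorem3p3 (R : realType) (H : hilbertType R)
    (H_separable : separable H) (H_infinite : infinite_dimensional H)
    (A : H -> H) (A_bounded : bounded_op A)
    (A_singular : ~ invertible_op A) (A_closed : closed (range A))
    (b : H) (S_nonempty : [set x | A x = b] !=set0)
    (T : H -> H) (T_positive : positive_op T)
    (T_invertible : invertible_op T) (T_closed : closed (range T))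
    (U : H -> ell2 R) (U_unitary : unitary_op U)
    (k : R^nat) (k_gt0 : forall n, 0 < k n)
    (k_bounded : exists M : R, forall n, k n <= M)
    (Tk : ell2 R -> ell2 R) (Tk_diagonal : diagonal_op k Tk)
    (T_diagonalized : T = adjoint U \o Tk \o U)
    (X : ell2 R -> ell2 R) (X_positive : positive_op X)
    (X_sqr : X \o X = Tk) :
  [set x | minimizer (fun y => inner y (T y)) [set y | A y = b] x] =
  [set (adjoint U \o op_inv X \o mp_inverse (A \o adjoint U \o op_inv X)) b].
Proof.
have [bU VU UV] := U_unitary; have [bV VP] := adjointP bU.
set V := adjoint U in VU UV bV VP T_diagonalized *.
have VUE x : V (U x) = x by have := congr1 (@^~ x) VU.
have UVE x : U (V x) = x by have := congr1 (@^~ x) UV.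
have [bX Xself _] := X_positive; have [_ XP] := adjointP bX; rewrite Xself in XP.
have TkE x : Tk x = U (T (V x)) by rewrite T_diagonalized /= !UVE.
have Tk_invertible : invertible_op Tk.
  have [Y [bY YT TY]] := T_invertible.
  exists (U \o Y \o V); split.
  - by apply: bounded_op_comp => //; exact: bounded_op_comp.
  - apply/funext => x /=; rewrite TkE VUE.
    by have /= -> := congr1 (@^~ (V x)) YT; rewrite UVE.
  - apply/funext => x /=; rewrite TkE VUE.
    by have /= -> := congr1 (@^~ (V x)) TY; rewrite UVE.
have [bXi XiX XXi] := op_invP (invertible_sqrt bX X_sqr Tk_invertible).
set Xi := op_inv X in bXi XiX XXi *.
have XiXE x : Xi (X x) = x by have := congr1 (@^~ x) XiX.
have XXiE x : X (Xi x) = x by have := congr1 (@^~ x) XXi.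
have costE y : inner y (T y) = (rnorm (X (U y)) ^+ 2)%:C%C.
  by rewrite T_diagonalized /= -X_sqr /= -VP -XP innerxx.
set B := A \o V \o Xi.
have bB : bounded_op B by apply: bounded_op_comp => //; exact: bounded_op_comp.
have BXU x : B (X (U x)) = A x by rewrite /B /= XiXE VUE.
have rB : range B = range A.
  apply/seteqP; split=> _ [x _ <-]; first by exists (V (Xi x)).
  by exists (X (U x)).
have mpB : is_mp_inverse B (mp_inverse B).
  by apply: mp_inverseP => //; rewrite rB; exact: closed_hclosed.
set c := mp_inverse B b.
have XUc : X (U (V (Xi c))) = c by rewrite UVE XXiE.
have Bc : B c = b.
  apply: (mp_solution mpB); rewrite rB.
  by have [x Ax] := S_nonempty; exists x.
have pyth y : A y = b ->
    rnorm (X (U y)) ^+ 2 = rnorm c ^+ 2 + rnorm (X (U y) - c) ^+ 2.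
  by move=> Ay; rewrite (mp_pythagoras bB mpB) BXU Ay.
rewrite [RHS](_ : _ = [set V (Xi c)])//.
apply/seteqP; split=> [x [/= Ax xmin]|_ -> /=].
  have := xmin (V (Xi c)); rewrite /= !costE XUc => /(_ Bc).
  rewrite lecR pyth// gerDl => le0.
  have /eqP : rnorm (X (U x) - c) ^+ 2 == 0 by rewrite eq_le le0 sqr_ge0.
  move=> /eqP; rewrite sqrf_eq0 => /eqP/rnorm_eq0/eqP; rewrite subr_eq0.
  by move=> /eqP <-; rewrite XiXE VUE.
split=> [|y /= Ay]; first exact: Bc.
by rewrite !costE lecR XUc pyth// lerDl sqr_ge0.
Qed.
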